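(* There exists an absolute constant $c>0$ such that the following holds. Let $\mathcal{C}=\{r_1 \bmod q_1,\dots,r_k \bmod q_k\}$ be a minimal covering system with distinct moduli $q_1<q_2<\cdots<q_k$. Then for every $j\in\{1,\dots,k\}$, the $j$-th smallest modulus satisfies $q_j\le \exp\!\big(c j^2/\log(j+1)\big)$.
   Context: A covering system is a finite set of arithmetic progressions (congruence classes $r \bmod q$ with $q\ge 1$) whose union is $\mathbb{Z}$. A covering system is minimal if no proper subset of its arithmetic progressions covers $\mathbb{Z}$. *)

(* Defs.v *)
From mathcomp Require Import all_boot all_order all_algebra.
From mathcomp Require Import all_classical all_reals all_analysis.
Set Implicit Arguments.
Unset Strict Implicit.
Unset Printing Implicit Defensive.
Import Order.TTheory GRing.Theory Num.Theory.
Local Open Scope classical_set_scope.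
Local Open Scope ring_scope.

Definition congruence_class (r : int) (q : nat) : set int :=
  [set n | (n = r %[mod q])%Z].

Definition covers (C : set (set int)) : Prop := \bigcup_(A in C) A = setT.

(* The elements of a system are the progressions themselves, as subsets of the
   integers, so two representations of one class count as the same element. *)
Definition covering_system (C : set (set int)) : Prop :=
  [/\ finite_set C,
      forall A, C A ->
        exists (r : int) (q : nat), (1 <= q)%N /\ A = congruence_class r q
    & covers C].

Definition minimal_covering_system (C : set (set int)) : Prop :=
  covering_system C /\ forall D, D `<` C -> ~ covers D.

(* Main.v *)
Require Import Defs.
From mathcomp Require Import all_boot all_order all_algebra all_field.
From mathcomp Require Import all_classical all_reals all_analysis.
From mathcomp Require Import ring lra zify.
Import Order.TTheory GRing.Theory Num.Theory.
Local Open Scope classical_set_scope.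
Local Open Scope ring_scope.
Set Implicit Arguments.
Unset Strict Implicit.
Unset Printing Implicit Defensive.

(* The distortion method of Balister, Bollobas, Morris, Sahasrabudhe and Tiba.
   Let [J] be the index of the modulus, counted from 1, and [y = 2 ^ (A * J)] for
   a large constant [A].  By minimality the first [J - 1] progressions miss an
   integer, hence miss a set of density at least [2 ^ (1 - J)].  If the [J]-th
   modulus exceeds [exp (c J^2 / log (J + 1))], then by Rankin's trick the other
   progressions with [y]-smooth modulus have total density at most [2 ^ - J], so
   the [y]-smooth part of the system leaves density at least [2 ^ - J] uncovered.
   The primes [p > y] are then added in increasing order: at each one the uniform
   measure is reweighted so that the newly covered set has small mass while the
   measure of every progression grows by at most a factor 2 per prime.  The mass
   lost at [p] is at most a second moment, which is [O(p^(-3/2))], so the total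
   loss is [O(y^(-1/2)) < 2 ^ - J] and something stays uncovered. *)

(** * Averages over residues *)

Definition has_period (T : Type) (N : nat) (f : nat -> T) :=
  forall x, f (x + N)%N = f x.

Lemma periodicMn (T : Type) (N : nat) (f : nat -> T) :
  has_period N f -> forall t x, f (x + N * t)%N = f x.
Proof.
move=> pf; elim=> [|t IH] x; first by rewrite muln0 addn0.
by rewrite mulnS addnA IH pf.
Qed.

Lemma periodic_dvd (T : Type) (N M : nat) (f : nat -> T) :
  (N %| M)%N -> has_period N f -> has_period M f.
Proof. by move=> /dvdnP[t ->] pf x; rewrite mulnC periodicMn. Qed.

Definition avg (R : realType) (Q : nat) (f : nat -> R) : R :=
  (\sum_(t < Q) f t) / Q%:R.

(** For [N %| Q] and [f] of period [Q], this is the conditional expectation of [f] given [x] mod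
    [N]: the points [x + N * t] run evenly over that class mod [Q]. *)
Definition fiber_avg (R : realType) (Q N : nat) (f : nat -> R) (x : nat) : R :=
  avg Q (fun t => f (x + N * t)%N).

Definition cls (R : realType) (a d x : nat) : R := (x == a %[mod d])%N%:R.

Lemma avg_shift (R : realType) (Q a : nat) (f : nat -> R) :
  has_period Q f -> avg Q (fun t => f (t + a)%N) = avg Q f.
Proof.
move=> pf; rewrite /avg; congr (_ / _).
elim: a => [|a <-]; first by apply: eq_bigr => i _; rewrite addn0.
case: Q pf => [|Q] pf; first by rewrite !big_ord0.
rewrite big_ord_recr big_ord_recl /= addrC; congr (_ + _).
  by rewrite addnS -addSn addnC pf add0n.
by apply: eq_bigr => i _; rewrite /bump /= add1n addnS addSn.
Qed.

Lemma avgD (R : realType) Q (f g : nat -> R) :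
  avg Q (fun x => f x + g x) = avg Q f + avg Q g.
Proof. by rewrite /avg big_split mulrDl. Qed.

Lemma avgZ (R : realType) Q (c : R) (f : nat -> R) :
  avg Q (fun x => c * f x) = c * avg Q f.
Proof. by rewrite /avg -mulr_sumr mulrA. Qed.

Lemma avg_sum (R : realType) Q (I : Type) (s : seq I) (f : I -> nat -> R) :
  avg Q (fun x => \sum_(i <- s) f i x) = \sum_(i <- s) avg Q (f i).
Proof. by rewrite /avg exchange_big mulr_suml. Qed.

Lemma eq_avg (R : realType) Q (f g : nat -> R) : f =1 g -> avg Q f = avg Q g.
Proof. by move=> fg; rewrite /avg; congr (_ / _); apply: eq_bigr. Qed.

Lemma ler_avg (R : realType) Q (f g : nat -> R) :
  (forall x, f x <= g x) -> avg Q f <= avg Q g.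
Proof. by move=> fg; rewrite /avg ler_wpM2r ?invr_ge0// ler_sum. Qed.

Lemma avg_cst (R : realType) Q (c : R) : (0 < Q)%N -> avg Q (fun=> c) = c.
Proof.
move=> Q0; rewrite /avg sumr_const card_ord -[c *+ Q]mulr_natr mulfK//.
by rewrite pnatr_eq0 -lt0n.
Qed.

Lemma avg_ge0 (R : realType) Q (f : nat -> R) :
  (forall x, 0 <= f x) -> 0 <= avg Q f.
Proof. by move=> f0; rewrite divr_ge0// sumr_ge0. Qed.

Lemma periodic_along (T : Type) Q N x (f : nat -> T) :
  has_period Q f -> has_period Q (fun t => f (x + N * t)%N).
Proof. by move=> pf t; rewrite mulnDr addnA (mulnC N Q) periodicMn. Qed.

Lemma fiber_avg_periodic (R : realType) Q N (f : nat -> R) :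
  has_period Q f -> has_period N (fiber_avg Q N f).
Proof.
move=> pf x; rewrite /fiber_avg.
rewrite -[RHS](@avg_shift R Q 1); last exact: periodic_along.
by apply: eq_avg => t; congr f; lia.
Qed.

(** Tower property. A shift by [N * t] changes neither [g] nor an average over a period, so one may
    also average over [t] and exchange the sums. *)
Lemma avg_fiber_avg (R : realType) Q N (f g : nat -> R) : (0 < Q)%N ->
  (N %| Q)%N -> has_period Q f -> has_period N g ->
  avg Q (fun x => g x * f x) = avg Q (fun x => g x * fiber_avg Q N f x).
Proof.
move=> Q0 NQ pf pg; have pg' := periodic_dvd NQ pg.
have -> : avg Q (fun x => g x * fiber_avg Q N f x) =
  avg Q (fun t => avg Q (fun x => g x * f (x + N * t)%N)).
  rewrite /fiber_avg {1 2}/avg; congr (_ / _).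
  rewrite [RHS](eq_bigr (fun t : 'I_Q => \sum_(x < Q) g x * f (x + N * t)%N / Q%:R)); last first.
    by move=> t _; rewrite /avg mulr_suml.
  rewrite exchange_big; apply: eq_bigr => x _.
  by rewrite /avg mulrA mulr_sumr mulr_suml.
rewrite -[LHS](avg_cst _ Q0); apply: eq_avg => t.
rewrite -(@avg_shift R Q (N * t)); last by move=> x; rewrite pf pg'.
by apply: eq_avg => x; rewrite (periodicMn pg).
Qed.

Lemma cls_periodic (R : realType) a d : has_period d (cls R a d).
Proof. by move=> x; rewrite /cls modnDr. Qed.

Lemma cls_ge0 (R : realType) a d x : 0 <= cls R a d x.
Proof. exact: ler0n. Qed.

(* The average does not depend on [a], because shifting [t] moves [a] by [N],
   and the averages over a full residue system sum to 1. *)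
Lemma fiber_avg_cls (R : realType) Q N a d x : (0 < Q)%N -> (0 < d)%N ->
  (d %| Q)%N -> coprime N d -> fiber_avg Q N (cls R a d) x = d%:R^-1.
Proof.
move=> Q0 d0 dQ cNd.
pose phi a := fiber_avg Q N (cls R a d) x.
have pQ b : has_period Q (cls R b d) := periodic_dvd dQ (cls_periodic R b d).
have phiN s b : phi (b + N * s)%N = phi b.
  rewrite /phi /fiber_avg -(@avg_shift R Q s); last exact: periodic_along.
  by apply: eq_avg => t; rewrite /cls mulnDr addnA eqn_modDr.
have phiE b c : b = c %[mod d] -> phi b = phi c.
  by move=> bc; apply: eq_avg => t; rewrite /cls bc.
have [s sE] : exists s, N * s = 1 %[mod d].
  have [N0|N0] := posnP N.
    by exists 0%N; move: cNd; rewrite N0 /coprime gcd0n => /eqP ->; rewrite !modn1.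
  case: (egcdnP d N0) => u v e _; exists u.
  by rewrite mulnC e modnMDl (eqP cNd).
have phiS b : phi b.+1 = phi b.
  rewrite -(phiN s b) -addn1; apply: phiE.
  by rewrite -modnDmr -[in RHS]modnDmr sE.
have phic b : phi b = phi 0%N by elim: b => // b <-.
have : \sum_(b < d) phi b = 1.
  rewrite /phi /fiber_avg -(avg_sum Q (index_enum 'I_d)
     (fun b t => cls R b d (x + N * t)%N)).
  rewrite -[RHS](avg_cst 1 Q0); apply: eq_avg => t.
  rewrite (bigD1 (Ordinal (ltn_pmod (x + N * t) d0)))//= /cls modn_mod eqxx.
  rewrite big1 ?addr0// => b nb; rewrite (modn_small (ltn_ord b)).
  by case: eqP => // e; case/eqP: nb; apply: val_inj.
rewrite (eq_bigr (fun=> phi a)); last by move=> b _; rewrite phic (phic a).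
rewrite sumr_const card_ord -[_ *+ _]mulr_natr -/(phi a) => h.
have d0R : d%:R != 0 :> R by rewrite pnatr_eq0 -lt0n.
by apply: (mulIf d0R); rewrite h mulVf.
Qed.

Lemma avg_cls (R : realType) Q a d : (0 < Q)%N -> (0 < d)%N ->
  (d %| Q)%N -> avg Q (cls R a d) = d%:R^-1.
Proof.
move=> Q0 d0 dQ; rewrite -(@fiber_avg_cls R Q 1 a d 0) ?coprime1n//.
by apply: eq_avg => t; rewrite add0n mul1n.
Qed.

(** * Density of the uncovered set *)

Definition expsum (F : fieldType) (s : seq (F * F)) (x : nat) : F :=
  \sum_(p <- s) p.1 * p.2 ^+ x.

(** The values satisfy the linear recurrence with monic characteristic polynomial [P], so each is
    determined by the [size s] preceding ones and zeros propagate. *)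
Lemma expsum_window (F : fieldType) (s : seq (F * F)) (x0 : nat) :
  (forall i, (i < size s)%N -> expsum s (x0 + i)%N = 0) ->
  forall i, expsum s (x0 + i)%N = 0.
Proof.
move=> h0; pose P : {poly F} := \prod_(p <- s) ('X - p.2%:P).
have sP : size P = (size s).+1 by rewrite /P size_prod_XsubC.
have Pm : P`_(size s) = 1.
  have := monic_prod_XsubC s predT (fun p : F * F => p.2).
  by rewrite -/P => /monicP; rewrite lead_coefE sP.
have rec x : \sum_(i < (size s).+1) P`_i * expsum s (x + i)%N = 0.
  transitivity (\sum_(p <- s) p.1 * p.2 ^+ x * P.[p.2]).
    rewrite (eq_bigr (fun i : 'I_(size s).+1 =>
      \sum_(p <- s) P`_i * (p.1 * p.2 ^+ (x + i)%N))); last first.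
      by move=> i _; rewrite mulr_sumr.
    rewrite exchange_big; apply: eq_bigr => p _ /=.
    rewrite horner_coef sP mulr_sumr; apply: eq_bigr => i _.
    by rewrite exprD; ring.
  rewrite big_seq big1// => p ps.
  have -> : P.[p.2] = 0.
    by rewrite horner_prod (big_rem _ ps) /= hornerXsubC subrr mul0r.
  by rewrite mulr0.
elim/ltn_ind => i IH; have [/h0//|si] := ltnP i (size s).
have := rec (x0 + (i - size s))%N.
rewrite big_ord_recr /= big1 => [|j _].
  by rewrite add0r Pm mul1r -addnA subnK.
rewrite -addnA IH ?mulr0//.
by have := ltn_ord j; lia.
Qed.

Definition uncovered (l : seq (nat * nat)) (x : nat) : bool :=
  all (fun rq => x != rq.1 %[mod rq.2])%N l.

(** Multiply over the classes the factors [1 - z ^+ x / z ^+ r], with [z] a primitive [q]-th root of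
    unity; each vanishes exactly on its class and doubles the number of terms. *)
Lemma uncovered_expsum (l : seq (nat * nat)) : all (fun rq => 0 < rq.2)%N l ->
  exists2 s : seq (algC * algC), size s = (2 ^ size l)%N &
    forall x, (expsum s x != 0) = uncovered l x.
Proof.
elim: l => [_|[r q] l IH /= /andP[q0 /IH[s ss sE]]].
  by exists [:: (1, 1)] => // x; rewrite /expsum big_seq1 /= expr1n mulr1 oner_neq0.
have [z zP] := C_prim_root_exists q0.
have z0 : z != 0.
  apply: contra_eq_neq (prim_expr_order zP) => ->.
  by rewrite expr0n gtn_eqF// eq_sym oner_neq0.
exists (s ++ [seq (- (z ^+ r)^-1 * p.1, z * p.2) | p <- s]) => [|x].
  by rewrite size_cat size_map ss expnS mul2n addnn.
have -> : expsum (s ++ [seq (- (z ^+ r)^-1 * p.1, z * p.2) | p <- s]) x =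
    (1 - z ^+ x / z ^+ r) * expsum s x.
  rewrite /expsum big_cat big_map mulrBl mul1r /= mulr_sumr -sumrN; congr (_ + _).
  by apply: eq_bigr => p _; rewrite exprMn; ring.
rewrite mulf_eq0 negb_or sE subr_eq0; congr (_ && _).
rewrite -(eq_prim_root_expr zP) -subr_eq0 -[in RHS]subr_eq0; congr (~~ _).
rewrite -(inj_eq (mulIf (expf_neq0 r z0))) mul0r mulrBl mul1r divfK ?expf_neq0//.
by rewrite -[in RHS]oppr_eq0 opprB.
Qed.

(* Crittenden and Vanden Eynden: by [expsum_window], [n] classes that miss a
   point miss one in every window of length [2 ^ n]. *)
Lemma uncovered_density (R : realType) (Q : nat) (l : seq (nat * nat)) :
  (0 < Q)%N -> all (fun rq => 0 < rq.2)%N l -> all (fun rq => rq.2 %| Q)%N l ->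
  (exists n, uncovered l n) ->
  (2 ^+ size l)^-1 <= avg Q (fun x => (uncovered l x)%:R : R).
Proof.
move=> Q0 l0 lQ [n un].
have pu : has_period Q (uncovered l).
  move=> x; apply: eq_in_all => -[r q] /(allP lQ) /= /dvdnP[k ->].
  by rewrite addnC modnMDl.
have [s ss sE] := uncovered_expsum l0.
have win x0 : exists2 i, (i < 2 ^ size l)%N & uncovered l (x0 + i)%N.
  apply/not_exists2P => h.
  (* The point [n + Q * x0] is uncovered by periodicity and lies beyond [x0], so a fully covered
     window would propagate to it. *)
  have : expsum s (x0 + (n + Q * x0 - x0))%N = 0.
    apply: expsum_window => i; rewrite ss => isz.
    by case: (h i) => // /negP; rewrite -sE negbK => /eqP.
  move/eqP; apply/negP; rewrite sE subnKC; last by nia.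
  by rewrite (periodicMn pu).
have puR : has_period Q (fun x => (uncovered l x)%:R : R) by move=> x; rewrite pu.
rewrite -[leLHS]mulr1 ler_pdivrMl ?exprn_gt0// -natrX.
apply: (@le_trans _ _ (avg Q (fun x => \sum_(i < 2 ^ size l) (uncovered l (x + i)%N)%:R))).
  rewrite -[leLHS](@avg_cst R Q 1 Q0); apply: ler_avg => x.
  have [i isz ui] := win x.
  by rewrite (bigD1 (Ordinal isz))//= ui lerDl sumr_ge0.
rewrite avg_sum (eq_bigr (fun=> avg Q (fun x => (uncovered l x)%:R : R))) => [|i _].
  by rewrite sumr_const card_ord mulr_natl.
exact: (@avg_shift R Q i).
Qed.

(** * Sums over primes *)

Lemma prod_primes_dvd (s : seq nat) (n : nat) : uniq s -> all prime s ->
  all (fun p => p %| n)%N s -> (\prod_(p <- s) p %| n)%N.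
Proof.
elim: s => [|p s IH] /=; first by rewrite big_nil dvd1n.
move=> /andP[ps us] /andP[pp prs] /andP[pn sn].
rewrite big_cons Gauss_dvd ?pn ?IH//.
rewrite big_seq; elim/big_ind: _ => [|x y cx cy|q qs].
- by rewrite coprimen1.
- by rewrite coprimeMr cx.
- rewrite prime_coprime// dvdn_prime2 ?(allP prs _ qs)//.
  by apply: contraNneq ps => ->.
Qed.

Lemma dvdn_bin_central (n p : nat) : prime p -> (n < p <= n.*2)%N ->
  (p %| 'C(n.*2, n))%N.
Proof.
move=> pp /andP[np pn].
have nf : ~~ (p %| n`!)%N.
  elim: n np {pn} => [|m IH] mp; first by rewrite dvdn1 neq_ltn prime_gt1 ?orbT.
  by rewrite factS Euclid_dvdM// negb_or IH ?(ltnW mp)// andbT gtnNdvd.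
have : (p %| n.*2`!)%N by rewrite dvdn_fact// prime_gt0.
rewrite -(@bin_fact n.*2 n) -?addnn ?leq_addr// addnK.
by rewrite !Euclid_dvdM// (negPf nf) !orbF.
Qed.

Lemma leq_bin_exp2 (n i : nat) : (i <= n)%N -> ('C(n, i) <= 2 ^ n)%N.
Proof.
rewrite -ltnS => lin; rewrite (expnDn 1 1) (bigD1 (Ordinal lin))//=.
by rewrite !exp1n !muln1 leq_addr.
Qed.

(* Chebyshev: the product of these primes divides [C(2^(k+1), 2^k)]. *)
Lemma dyadic_primes_count (k : nat) :
  (k * size [seq p <- index_iota (2 ^ k).+1 (2 ^ k.+1).+1 | prime p] <= 2 ^ k.+1)%N.
Proof.
set s := [seq p <- _ | prime p].
rewrite -(@leq_exp2l 2)// expnM.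
have sP p : p \in s -> prime p /\ (2 ^ k < p <= (2 ^ k).*2)%N.
  by rewrite mem_filter mem_index_iota ltnS expnS mul2n => /andP[].
apply: (@leq_trans (\prod_(p <- s) p)%N).
  elim: s sP => [|p s IH] sP; first by rewrite big_nil.
  rewrite big_cons expnS leq_mul//.
    by have [_ /andP[/ltnW]] := sP p (mem_head _ _).
  by apply: IH => q qs; apply: sP; rewrite in_cons qs orbT.
apply: (@leq_trans 'C((2 ^ k).*2, 2 ^ k)).
  apply: dvdn_leq; first by rewrite bin_gt0 -addnn leq_addr.
  apply: prod_primes_dvd; first by rewrite filter_uniq ?iota_uniq.
  - by apply/allP => p /sP[].
  - by apply/allP => p /sP[pp ?]; apply: dvdn_bin_central.
by rewrite expnS mul2n leq_bin_exp2 // -addnn leq_addr.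
Qed.

Definition prime_recip_sum (R : realType) (n : nat) : R :=
  \sum_(0 <= p < n.+1 | prime p) p%:R^-1.

(** By Chebyshev the primes between [2 ^ k] and [2 ^ k.+1] contribute at most [2 / k]. Comparing
    with a telescoping square root is crude but enough for both later uses. *)
Lemma prime_recip_sum_le (R : realType) (m : nat) :
  prime_recip_sum R (2 ^ m.+1) <= 1 / 2 + 4 * Num.sqrt m%:R.
Proof.
elim: m => [|m IH].
  rewrite sqrtr0 mulr0 addr0 /prime_recip_sum expn1.
  by rewrite big_mkcond !big_nat_recr//= big_geq// !add0r div1r.
rewrite /prime_recip_sum (@big_cat_nat _ _ _ (2 ^ m.+1).+1)//=; last first.
  by rewrite ltnS leq_exp2l.
apply: (le_trans (lerD IH (_ : _ <= 2 / m.+1%:R))).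
  rewrite -big_filter.
  apply: (@le_trans _ _ (\sum_(i <- [seq p <-
      index_iota (2 ^ m.+1).+1 (2 ^ m.+2).+1 | prime p]) (2 ^ m.+1)%:R^-1)).
    rewrite big_seq [leRHS]big_seq; apply: ler_sum => p.
    rewrite mem_filter mem_index_iota => /andP[_ /andP[mp _]].
    by rewrite lef_pV2 ?posrE ?ltr0n ?expn_gt0 ?(leq_ltn_trans _ mp)// ler_nat ltnW.
  rewrite big_const_seq count_predT iter_addr_0.
  have := dyadic_primes_count m.+1.
  set c := size _ => h.
  rewrite -[_ *+ c]mulr_natl ler_pdivlMr ?ltr0n// mulrAC ler_pdivrMr ?ltr0n ?expn_gt0//.
  by rewrite -!natrM ler_nat mulnC -expnS.
set a := Num.sqrt m%:R; set b := Num.sqrt m.+1%:R.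
have aE : a ^+ 2 = m%:R by rewrite sqr_sqrtr.
have bE : b ^+ 2 = m%:R + 1 by rewrite sqr_sqrtr// -natr1.
have a0 : 0 <= a by exact: sqrtr_ge0.
have b1 : 1 <= b by rewrite -sqrtr1 ler_wsqrtr// ler1n.
rewrite -addrA lerD2l -[m.+1%:R]natr1 -bE.
have m0 : 0 <= m%:R :> R by [].
have ab : a <= b by nra.
have -> : 4 * b = 4 * a + 4 * (b - a) by ring.
rewrite lerD2l ler_pdivrMr ?exprn_gt0//; last by lra.
have : (b - a) * (b + a) = 1 by rewrite mulrBl !mulrDr -!expr2 aE bE; ring.
nra.
Qed.

(** * Smooth numbers *)

(* The exponents are capped at [T] to keep the list finite. *)
Fixpoint smooth (T n : nat) : seq nat :=
  if n is n'.+1 then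
    if prime n then [seq (m * n ^ k)%N | m <- smooth T n', k <- index_iota 0 T.+1]
    else smooth T n'
  else [:: 1%N].

(** A common multiple of [smooth T n]: stage [n] lives on the residues modulo it, and a new prime
    [p] brings the coprime factor [p ^ T]. *)
Fixpoint smooth_modulus (T n : nat) : nat :=
  if n is n'.+1 then
    if prime n then (smooth_modulus T n' * n ^ T)%N else smooth_modulus T n'
  else 1%N.

Lemma smoothS T n : smooth T n.+1 =
  if prime n.+1 then [seq (m * n.+1 ^ k)%N | m <- smooth T n, k <- index_iota 0 T.+1]
  else smooth T n.
Proof. by []. Qed.

Lemma smooth_modulus_gt0 T n : (0 < smooth_modulus T n)%N.
Proof. by elim: n => //= n IH; case: ifP => // _; rewrite muln_gt0 IH expn_gt0. Qed.

Lemma smooth_modulus_coprime T n p : prime p -> (n < p)%N ->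
  coprime (smooth_modulus T n) p.
Proof.
move=> pp; elim: n => [|n IH] np /=; first by rewrite coprime1n.
case: ifP => [pn|_]; last exact/IH/ltnW.
rewrite coprimeMl IH 1?ltnW//= coprimeXl// prime_coprime// dvdn_prime2//.
by rewrite ltn_eqF.
Qed.

Lemma smooth_dvd T n m : m \in smooth T n -> (m %| smooth_modulus T n)%N.
Proof.
elim: n m => [|n IH] m; first by rewrite inE => /eqP ->.
rewrite smoothS [smooth_modulus _ _]/=.
case: ifP => [pn /allpairsP[[d k] [/= /IH dn]]|_ /IH//].
rewrite mem_index_iota ltnS => kT ->.
by rewrite dvdn_mul// dvdn_exp2l.
Qed.

Lemma smooth_gt0 T n m : m \in smooth T n -> (0 < m)%N.
Proof. by move=> /smooth_dvd; apply: dvdn_gt0; exact: smooth_modulus_gt0. Qed.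

Lemma dvdn_smooth_modulus T n m : prime n.+1 -> (m %| smooth_modulus T n.+1)%N ->
  exists d k, [/\ (d %| smooth_modulus T n)%N, (k <= T)%N & m = (d * n.+1 ^ k)%N].
Proof.
move=> pn; have := smooth_modulus_gt0 T n.+1 => N0 mN.
have m0 := dvdn_gt0 N0 mN.
have [d cd mE] := pfactor_coprime pn m0.
exists d, (logn n.+1 m); split => //.
  move: mN; rewrite {1}mE /= pn => /(dvdn_trans (dvdn_mulr _ (dvdnn d))).
  by rewrite Gauss_dvdl// coprimeXr// coprime_sym.
move: mN; rewrite {1}mE /= pn => /(dvdn_trans (dvdn_mull _ (dvdnn _))).
rewrite Gauss_dvdr ?dvdn_Pexp2l ?prime_gt1//.
by rewrite coprimeXl// coprime_sym smooth_modulus_coprime.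
Qed.

Lemma mem_smooth T n d : (0 < d)%N ->
  (forall p, prime p -> (p %| d)%N -> (p <= n)%N /\ (logn p d <= T)%N) ->
  d \in smooth T n.
Proof.
elim: n d => [|n IH] d d0 dP.
  rewrite inE; apply: contraT => d1.
  have d_gt1 : (1 < d)%N by lia.
  have [+ _] := dP _ (pdiv_prime d_gt1) (pdiv_dvd d).
  by rewrite leqn0 => /eqP p0; have := pdiv_prime d_gt1; rewrite p0.
rewrite smoothS; case: ifP => [pn|npn].
  have [m cm mE] := pfactor_coprime pn d0.
  have m0 : (0 < m)%N by move: d0; rewrite mE muln_gt0 => /andP[].
  apply/allpairsP; exists (m, logn n.+1 d); split => //=.
    apply: IH => // p pp pm.
    have pd : (p %| d)%N by rewrite mE dvdn_mulr.
    have [pn1 lpT] := dP p pp pd.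
    have pneq : p != n.+1.
      by apply: contraTneq cm => <-; rewrite prime_coprime// pm.
    split; first by lia.
    apply: leq_trans lpT; rewrite [in leqRHS]mE lognM ?expn_gt0//.
    exact: leq_addr.
  rewrite mem_index_iota ltnS.
  have [/dP[]//|nd] := boolP (n.+1 %| d)%N.
  by rewrite (@logn_coprime n.+1 d) ?prime_coprime.
apply: IH => // p pp pd; have [pn lpT] := dP p pp pd; split => //.
have : p != n.+1 by apply: contraTneq pp => ->; rewrite npn.
by lia.
Qed.

Lemma mem_smooth_le T n d : (0 < d)%N -> (d <= n)%N -> (d <= T)%N ->
  d \in smooth T n.
Proof.
move=> d0 dn dT; apply: mem_smooth => // p pp pd; split.
  by apply: leq_trans dn; apply: dvdn_leq.
by apply: leq_trans dT; apply: ltnW; apply: ltn_logl.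
Qed.

(** * A multiplicative weight and its sum over lcms *)

Definition omega (m : nat) : nat := size (primes m).

Lemma omegaMX m p k : prime p -> (0 < m)%N -> coprime m p -> (0 < k)%N ->
  omega (m * p ^ k) = (omega m).+1.
Proof.
move=> pp m0 cmp k0; rewrite /omega -[RHS]/(size (p :: primes m)).
apply: perm_size; apply: uniq_perm; rewrite /= ?primes_uniq ?andbT//.
  by rewrite mem_primes pp m0 /= -prime_coprime// coprime_sym.
move=> q; rewrite primesM ?expn_gt0 ?(prime_gt0 pp)// primesX// (primes_prime pp).
by rewrite mem_seq1 in_cons orbC.
Qed.

(* The reweighting at a prime may double the mass [1 / m] of a class mod [m],
   but only at primes dividing [m]. *)
Definition weight (R : realType) (m : nat) : R := 2 ^+ omega m / m%:R.

Lemma weight_ge0 (R : realType) m : 0 <= weight R m.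
Proof. by rewrite divr_ge0// exprn_ge0. Qed.

(** Local factor at [p ^ k] of the multiplicative function [weight]. *)
Definition pweight (R : realType) (p k : nat) : R :=
  if k is 0 then 1 else 2 / p%:R ^+ k.

Lemma weightMX (R : realType) m p k : prime p -> (0 < m)%N -> coprime m p ->
  weight R (m * p ^ k) = weight R m * pweight R p k.
Proof.
move=> pp m0 cmp; case: k => [|k]; first by rewrite expn0 muln1 mulr1.
by rewrite /weight omegaMX//= exprS natrM natrX invfM; ring.
Qed.

Lemma lcmnM_coprime a b q : coprime a q -> coprime b q ->
  lcmn a (b * q) = (lcmn a b * q)%N.
Proof.
move=> ca cb; apply/eqP; rewrite eqn_dvd dvdn_lcm; apply/andP; split.
  by rewrite dvdn_mulr ?dvdn_lcml// dvdn_mul ?dvdn_lcmr.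
rewrite Gauss_dvd; last first.
  apply: (@coprime_dvdl _ (a * b)); last by rewrite coprimeMl ca.
  by rewrite dvdn_lcm dvdn_mulr ?dvdn_mull.
rewrite dvdn_lcm dvdn_lcml /=; apply/andP; split.
  by apply: dvdn_trans (dvdn_lcmr _ _); rewrite dvdn_mulr.
by apply: dvdn_trans (dvdn_lcmr _ _); rewrite dvdn_mull.
Qed.

Lemma lcmnMX a b p j k : prime p -> coprime a p -> coprime b p ->
  lcmn (a * p ^ j) (b * p ^ k) = (lcmn a b * p ^ maxn j k)%N.
Proof.
move=> pp.
wlog jk : a b j k / (j <= k)%N => [H ca cb|ca cb].
  have /orP[h|h] := leq_total j k; first exact: H.
  by rewrite lcmnC (H b a)// lcmnC maxnC.
rewrite (maxn_idPr jk) -(subnK jk) expnD !mulnA -muln_lcml; congr (_ * _)%N.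
by rewrite lcmnM_coprime ?coprimeXr.
Qed.

(** This double sum arises from squaring a sum over classes: classes mod [a] and mod [b] meet in a
    class mod [lcmn a b] or not at all. *)
Definition lcm_weight (R : realType) (T n : nat) : R :=
  \sum_(a <- smooth T n) \sum_(b <- smooth T n) weight R (lcmn a b).

Lemma lcm_weight_ge0 (R : realType) T n : 0 <= lcm_weight R T n.
Proof. by apply: sumr_ge0 => a _; apply: sumr_ge0 => b _; exact: weight_ge0. Qed.

Lemma lcm_weightS (R : realType) T n : prime n.+1 ->
  lcm_weight R T n.+1 = lcm_weight R T n *
    \sum_(0 <= j < T.+1) \sum_(0 <= k < T.+1) pweight R n.+1 (maxn j k).
Proof.
move=> pn; rewrite /lcm_weight smoothS pn big_allpairs_dep mulr_suml.
rewrite big_seq [RHS]big_seq; apply: eq_bigr => a aS.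
transitivity (\sum_(0 <= j < T.+1) \sum_(b <- smooth T n)
   weight R (lcmn a b) * \sum_(0 <= k < T.+1) pweight R n.+1 (maxn j k)).
  apply: eq_bigr => j _; rewrite big_allpairs_dep.
  rewrite big_seq [RHS]big_seq; apply: eq_bigr => b bS.
  rewrite mulr_sumr; apply: eq_bigr => k _.
  have c m : m \in smooth T n -> coprime m n.+1.
    by move=> /smooth_dvd/coprime_dvdl; apply; exact: smooth_modulus_coprime.
  rewrite lcmnMX ?c// weightMX// ?lcmn_gt0 ?(smooth_gt0 aS) ?(smooth_gt0 bS)//.
  apply: (@coprime_dvdl _ (a * b)); last by rewrite coprimeMl !c.
  by rewrite dvdn_lcm dvdn_mulr ?dvdn_mull.
by rewrite exchange_big mulr_suml; apply: eq_bigr => b _; rewrite mulr_sumr.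
Qed.

(** Exactly [2 k + 1] pairs have maximum [k], so this truncates the series of [(4 k + 2) / p ^ k]
    over [k >= 1], plus 1. The constant 20 is what [p = 2] demands. *)
Lemma sum_pweight_max_le (R : realType) T p : prime p ->
  \sum_(0 <= j < T.+1) \sum_(0 <= k < T.+1) pweight R p (maxn j k)
    <= 1 + 20 / p%:R :> R.
Proof.
move=> pp; have p2 : 2 <= p%:R :> R by rewrite ler_nat prime_gt1.
have p0 : 0 < p%:R :> R by lra.
case: T => [|T]; first by rewrite !big_nat1 /= lerDl divr_ge0// ltW.
(* The subtracted term is what makes the induction on [T] close. *)
suff : \sum_(0 <= j < T.+2) \sum_(0 <= k < T.+2) pweight R p (maxn j k)
    <= 1 + 20 / p%:R - (4 * T%:R + 14) / p%:R ^+ T.+1.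
  move=> /le_trans; apply; rewrite gerBl divr_ge0 ?exprn_ge0//.
elim: T => [|T IH].
  rewrite !big_nat_recr//= !big_geq// /maxn /= !expr1 mulr0 add0r.
  by rewrite le_eqVlt; apply/orP; left; apply/eqP; ring.
have -> : \sum_(0 <= j < T.+3) \sum_(0 <= k < T.+3) pweight R p (maxn j k) =
   \sum_(0 <= j < T.+2) \sum_(0 <= k < T.+2) pweight R p (maxn j k) +
   (2 * T%:R + 5) * (2 / p%:R ^+ T.+2).
  have mx j : (j <= T.+2)%N -> maxn j T.+2 = T.+2 by move/maxn_idPr.
  have mx' k : (k < T.+3)%N -> pweight R p (maxn T.+2 k) = 2 / p%:R ^+ T.+2.
    by move=> kT; rewrite maxnC mx.
  rewrite big_nat_recr//= (eq_big_nat _ _ (F2 := fun j =>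
    \sum_(0 <= k < T.+2) pweight R p (maxn j k) + 2 / p%:R ^+ T.+2)); last first.
    by move=> j /= jT; rewrite big_nat_recr//= mx// ltnW.
  rewrite big_split /= -addrA; congr (_ + _).
  rewrite [X in _ + X](eq_big_nat _ _ (F2 := fun=> 2 / p%:R ^+ T.+2)); last first.
    by move=> k /andP[_ kT]; exact: mx'.
  rewrite !sumr_const_nat !subn0 -mulrnDr -[LHS]mulr_natl; congr (_ * _).
  by rewrite -addSnnS natrD -!natr1; ring.
apply: (le_trans (lerD IH (lexx _))).
rewrite -[T.+1%:R]natr1 [p%:R ^+ T.+2]exprS invfM.
set x := (p%:R ^+ T.+1)^-1; have x0 : 0 < x by rewrite invr_gt0 exprn_gt0.
set y := p%:R^-1; have y0 : 0 < y by rewrite invr_gt0.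
have py : y * p%:R = 1 by rewrite mulVf// gt_eqF.
have y2 : y <= 1 / 2 by nra.
have T0 : 0 <= T%:R :> R by [].
have := mulr_ge0 (ltW x0) (mulr_ge0 (_ : 0 <= 8 * T%:R + 28) (_ : 0 <= 1 / 2 - y)).
move=> /(_ ltac:(lra) ltac:(lra)); set u := T%:R.
suff -> : x * ((8 * u + 28) * (1 / 2 - y)) = (4 * u + 14) * x - (8 * u + 28) * (x * y) by lra.
by field.
Qed.

Lemma lcm_weight_le (R : realType) T n :
  lcm_weight R T n <= expR (20 * prime_recip_sum R n).
Proof.
elim: n => [|n IH].
  rewrite /lcm_weight /prime_recip_sum !big_seq1 big_mkcond big_nat1 /=.
  by rewrite mulr0 expR0 /weight (_ : lcmn 1 1 = 1%N)// expr0 divr1.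
rewrite /prime_recip_sum big_mkcond big_nat_recr//= -big_mkcond.
rewrite -/(prime_recip_sum R n) mulrDr expRD.
have [pn|npn] := boolP (prime n.+1); last first.
  by rewrite /lcm_weight smoothS (negPf npn) mulr0 expR0 mulr1.
rewrite lcm_weightS//; apply: ler_pM => //.
- exact: lcm_weight_ge0.
- apply: sumr_ge0 => j _; apply: sumr_ge0 => k _.
  by case: (maxn j k) => //= i; rewrite divr_ge0// exprn_ge0.
- by apply: (le_trans (sum_pweight_max_le R T pn)); exact: expR_ge1Dx.
Qed.

(** * The distortion step *)

Lemma eq_mod_lcm a b m n :
  (a == b %[mod m] -> a == b %[mod n] -> a == b %[mod lcmn m n])%N.
Proof.
wlog ba : a b / (b <= a)%N => [H|].
  have /orP[h|h] := leq_total a b; last exact: H.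
  by rewrite ![(a %% _ == _)%N]eq_sym; exact: H.
by rewrite !eqn_mod_dvd// dvdn_lcm => -> ->.
Qed.

(** The two classes meet in a class modulo the lcm or are disjoint; [0 <= B] settles the second
    case. *)
Lemma avg_cls2_le (R : realType) Q (w : nat -> R) (B : R) a b m n :
  (forall x, 0 <= w x) -> 0 <= B ->
  (forall c, avg Q (fun x => w x * cls R c (lcmn m n) x) <= B) ->
  avg Q (fun x => w x * (cls R a m x * cls R b n x)) <= B.
Proof.
move=> w0 B0 H.
have [[y /andP[ya yb]]|no] := pselect (exists y, (y == a %[mod m]) && (y == b %[mod n]))%N.
  apply: le_trans (H y); apply: ler_avg => x; apply: ler_wpM2l => //.
  rewrite /cls -natrM mulnb ler_nat.
  case: andP => // -[xa xb]; rewrite eq_mod_lcm//.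
    by rewrite (eqP xa) eq_sym.
  by rewrite (eqP xb) eq_sym.
apply: le_trans B0; rewrite -[leRHS](_ : avg Q (fun=> 0) = 0); last first.
  by rewrite /avg big1 ?mul0r.
apply: ler_avg => x; rewrite /cls -natrM mulnb.
have [xab|_] := boolP ((x == a %[mod m]) && (x == b %[mod n]))%N; last by rewrite mulr0.
by case: no; exists x.
Qed.

(** Fiber averages 1 keep the mass of [N]-periodic functions. The set [b] retains fiber mass 0 where
    [alpha < 1 / 2] and [2 * alpha - 1] elsewhere, and [2 * alpha - 1 <= alpha ^+ 2]. *)
Lemma distortion (R : realType) Q N N' (b : nat -> bool) : (0 < Q)%N ->
  has_period Q b -> has_period N' b -> (N %| N')%N ->
  let alpha := fiber_avg Q N (fun x => (b x)%:R : R) in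
  exists h : nat -> R, [/\ forall x, 0 <= h x <= 2, has_period N' h,
    forall x, fiber_avg Q N h x = 1 &
    forall x, fiber_avg Q N (fun y => h y * (b y)%:R) x <= alpha x ^+ 2].
Proof.
move=> Q0 bQ bN' NN' alpha.
have aN : has_period N alpha by apply: fiber_avg_periodic => x; rewrite bQ.
have aE x t : alpha (x + N * t)%N = alpha x by rewrite (periodicMn aN).
(* Since [alpha] is constant on a fiber, the weights used below are affine in the indicator of [b]
   there. *)
have affine (f : nat -> R) c d x :
    (forall y, alpha y = alpha x -> f y = c + d * (b y)%:R) ->
    fiber_avg Q N f x = c + d * alpha x.
  move=> fE; rewrite -[c in RHS](avg_cst _ Q0) -avgZ -avgD.
  by apply: eq_avg => t; rewrite fE.
have a0 x : 0 <= alpha x by apply: avg_ge0 => t; rewrite ler0n.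
(* Remove the points of [b] where they are sparse in the fiber; elsewhere only
   lower their mass, so that the density never exceeds 2. *)
pose h x : R := if alpha x < 1 / 2 then (1 - (b x)%:R) / (1 - alpha x)
                else 2 - (b x)%:R / alpha x.
exists h; split.
- move=> x; rewrite /h; case: ltP => hx.
    have i0 : 0 < (1 - alpha x)^-1 by rewrite invr_gt0; lra.
    have : (1 - alpha x)^-1 * (1 - alpha x) = 1 by rewrite mulVf//; lra.
    by case: (b x) => /=; nra.
  have i0 : 0 < (alpha x)^-1 by rewrite invr_gt0; lra.
  have : (alpha x)^-1 * alpha x = 1 by rewrite mulVf//; lra.
  by case: (b x) => /=; nra.
- by move=> x; rewrite /h bN' (periodic_dvd NN' aN).
- move=> x; case: (ltP (alpha x) (1 / 2)) => hx.
    rewrite (affine _ (1 - alpha x)^-1 (- (1 - alpha x)^-1)).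
      by field; lra.
    by move=> y yx; rewrite /h yx hx; ring.
  rewrite (affine _ 2 (- (alpha x)^-1)).
    by field; lra.
  by move=> y yx; rewrite /h yx ltNge hx /=; ring.
- move=> x; case: (ltP (alpha x) (1 / 2)) => hx.
    rewrite (affine _ 0 0) ?mul0r ?addr0 ?sqr_ge0//.
    by move=> y yx; rewrite /h yx hx; case: (b y); rewrite /= ?subrr ?mul0r ?mulr0 ?addr0.
  rewrite (affine _ 0 (2 - (alpha x)^-1)).
    rewrite add0r mulrBl mulVf; last by lra.
    by rewrite -subr_ge0 (_ : _ - _ = (alpha x - 1) ^+ 2) ?sqr_ge0//; ring.
  by move=> y yx; rewrite /h yx ltNge hx /=; case: (b y); rewrite /= ?mulr0 ?mulr1 ?add0r ?mul1r.
Qed.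

(** The residue can be a function [a] of the modulus because the moduli of the theorem are
    distinct. *)
Definition avoids (D : pred nat) (a : nat -> nat) (s : seq nat) (x : nat) : bool :=
  all (fun d => D d ==> (x != a d %[mod d]))%N s.

(** The exponents start at 1: for prime [n.+1] these are the moduli that appear on passing from [n]
    to [n.+1]. *)
Definition new_hit (D : pred nat) (a : nat -> nat) (T n x : nat) : bool :=
  has (fun d => D d && (x == a d %[mod d]))%N
    [seq (m * n.+1 ^ k)%N | m <- smooth T n, k <- index_iota 1 T.+1].

Lemma avoids_periodic D a T n :
  has_period (smooth_modulus T n) (avoids D a (smooth T n)).
Proof.
move=> x; apply: eq_in_all => d /smooth_dvd/dvdnP[k ->].
by rewrite addnC modnMDl.
Qed.

Lemma smooth_new T n : prime n.+1 ->
  smooth T n.+1 =i smooth T n ++ [seq (m * n.+1 ^ k)%N | m <- smooth T n, k <- index_iota 1 T.+1].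
Proof.
move=> pn d; rewrite smoothS pn mem_cat; apply/allpairsP/orP.
  move=> [[m [|k]] [/= mS kT ->]]; first by left; rewrite expn0 muln1.
  by right; apply/allpairsP; exists (m, k.+1); split => //; move: kT; rewrite !mem_index_iota.
case=> [dS|/allpairsP[[m k] [/= mS kT ->]]].
  by exists (d, 0%N); split; rewrite //= muln1.
exists (m, k); split => //.
by move: kT; rewrite !mem_index_iota /= => /andP[].
Qed.

Lemma avoidsS D a T n x : prime n.+1 ->
  avoids D a (smooth T n.+1) x = avoids D a (smooth T n) x && ~~ new_hit D a T n x.
Proof.
move=> pn; rewrite /avoids (eq_all_r (smooth_new T pn)) all_cat; congr (_ && _).
by rewrite /new_hit -all_predC; apply: eq_all => d /=; rewrite negb_and implybE.
Qed.

Lemma new_hit_periodic D a T n : prime n.+1 ->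
  has_period (smooth_modulus T n.+1) (new_hit D a T n).
Proof.
move=> pn x; apply: eq_in_has => d dS.
have /smooth_dvd/dvdnP[k ->] : d \in smooth T n.+1 by rewrite smooth_new// mem_cat dS orbT.
by rewrite addnC modnMDl.
Qed.

Lemma smooth_modulus_dvd T n M : (n <= M)%N ->
  (smooth_modulus T n %| smooth_modulus T M)%N.
Proof.
move=> /subnK <-; elim: (M - n)%N => [|k IH]; first by rewrite add0n.
by rewrite addSn /=; case: ifP => // _; rewrite dvdn_mulr.
Qed.

Lemma sum_expV_le (R : realType) T p : prime p ->
  \sum_(1 <= k < T.+1) (p%:R ^+ k)^-1 <= 2 / p%:R :> R.
Proof.
move=> pp; have p2 : 2 <= p%:R :> R by rewrite ler_nat prime_gt1.
have y0 : 0 < p%:R^-1 :> R by rewrite invr_gt0; lra.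
have py : p%:R^-1 * p%:R = 1 :> R by rewrite mulVf//; lra.
have x0 k : 0 < (p%:R ^+ k)^-1 :> R by rewrite invr_gt0 exprn_gt0//; lra.
suff : \sum_(1 <= k < T.+1) (p%:R ^+ k)^-1 <= 2 / p%:R * (1 - (p%:R ^+ T)^-1) :> R.
  by have := x0 T; nra.
elim: T => [|T IH]; first by rewrite big_geq// expr0 invr1 subrr mulr0.
rewrite big_nat_recr//=; apply: (le_trans (lerD IH (lexx _))).
have := x0 T; rewrite exprS invfM; move: y0 py.
set x := (p%:R ^+ T)^-1; set y := p%:R^-1 => y0 py xT.
have y2 : 0 <= 1 - 2 * y by nra.
have := mulr_ge0 (mulr_ge0 (ltW xT) (ltW y0)) y2.
have -> : x * y * (1 - 2 * y) = x * y - 2 * y * (y * x) by ring.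
lra.
Qed.

(** Invariant of the iteration. At [m = 1] it bounds the total mass by 1. *)
Definition spread (R : realType) (T M n : nat) (w : nat -> R) : Prop :=
  forall m c, (m %| smooth_modulus T n)%N ->
    avg (smooth_modulus T M) (fun x => w x * cls R c m x) <= weight R m.

Lemma cls_mulM (R : realType) c m n x :
  cls R c (m * n) x <= cls R c m x * cls R c n x.
Proof.
rewrite /cls -natrM mulnb ler_nat.
case: eqP => // xc.
have e d : (d %| m * n)%N -> (x = c %[mod d])%N.
  by move=> dmn; rewrite -(modn_dvdm x dmn) xc modn_dvdm.
by rewrite (e m) ?dvdn_mulr// (e n) ?dvdn_mull// !eqxx.
Qed.

(** Union bound. A class mod [m * p ^ k] is cut out by a class mod [m], constant on the fiber as [m]
    divides [N], and one mod [p ^ k], of density [p ^ (- k)] there by coprimality. *)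
Lemma fiber_avg_new_hit_le (R : realType) D a T M n x : prime n.+1 -> (n < M)%N ->
  fiber_avg (smooth_modulus T M) (smooth_modulus T n)
    (fun y => (new_hit D a T n y)%:R : R) x <=
  \sum_(l <- [seq (m, k) | m <- smooth T n, k <- index_iota 1 T.+1])
    (n.+1%:R ^+ l.2)^-1 * cls R (a (l.1 * n.+1 ^ l.2)%N) l.1 x.
Proof.
move=> pn nM; set N := smooth_modulus T n; set Q := smooth_modulus T M.
set L := [seq (m, k) | m <- smooth T n, k <- index_iota 1 T.+1].
have Q0 : (0 < Q)%N by exact: smooth_modulus_gt0.
have LP l : l \in L -> (l.1 %| N)%N /\ (l.2 <= T)%N.
  move=> /allpairsP[[m k] [/= mS + ->]] /=.
  by rewrite mem_index_iota => /andP[_ kT]; split; first exact: smooth_dvd.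
apply: (@le_trans _ _ (avg Q (fun t => \sum_(l <- L)
    cls R (a (l.1 * n.+1 ^ l.2)%N) l.1 x *
    cls R (a (l.1 * n.+1 ^ l.2)%N) (n.+1 ^ l.2) (x + N * t)%N))).
  apply: ler_avg => t.
  have term0 l : 0 <= cls R (a (l.1 * n.+1 ^ l.2)%N) l.1 x *
    cls R (a (l.1 * n.+1 ^ l.2)%N) (n.+1 ^ l.2) (x + N * t)%N.
    by rewrite mulr_ge0 ?cls_ge0.
  have [/hasP[d dS /andP[_ xd]]|_] := boolP (new_hit _ _ _ _ _); last by rewrite sumr_ge0.
  have [[m k] [/= mS kT dE]] := allpairsP dS.
  have lL : (m, k) \in L by apply/allpairsP; exists (m, k).
  rewrite (big_rem _ lL) /=; apply: ler_wpDr; first by rewrite sumr_ge0.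
  have [/dvdnP[q NE] _] := LP _ lL.
  rewrite -[cls R _ m x](periodicMn (cls_periodic R _ m) (q * t)%N) /=.
  rewrite (_ : m * (q * t) = N * t)%N; last by rewrite NE; ring.
  by apply: le_trans (cls_mulM _ _ _ _ _); rewrite -dE /cls xd.
rewrite avg_sum big_seq [leRHS]big_seq; apply: ler_sum => l /LP[lN lT].
rewrite avgZ mulrC; apply: ler_wpM2r; first exact: cls_ge0.
rewrite -/(fiber_avg Q N (cls R _ _) x) fiber_avg_cls ?expn_gt0 ?natrX//.
  apply: (@dvdn_trans (smooth_modulus T n.+1)); last exact: smooth_modulus_dvd.
  by rewrite /= pn dvdn_mull// dvdn_exp2l.
by apply: coprimeXr; exact: smooth_modulus_coprime.
Qed.

(** Squaring the union bound produces pairs of classes, and [spread] controls each intersection. The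
    sum factors: powers of the new prime give [(2 / p) ^ 2] and the rest [lcm_weight]. *)
Lemma second_moment_le (R : realType) D a T M n (w : nat -> R) :
  prime n.+1 -> (n < M)%N -> (forall x, 0 <= w x) -> spread T M n w ->
  avg (smooth_modulus T M) (fun x => w x *
    fiber_avg (smooth_modulus T M) (smooth_modulus T n)
      (fun y => (new_hit D a T n y)%:R) x ^+ 2) <=
  (2 / n.+1%:R) ^+ 2 * lcm_weight R T n.
Proof.
move=> pn nM w0 sw; set N := smooth_modulus T n; set Q := smooth_modulus T M.
set L := [seq (m, k) | m <- smooth T n, k <- index_iota 1 T.+1].
set c := fun l : nat * nat => (n.+1%:R ^+ l.2)^-1 : R.
set K := fun (l : nat * nat) => cls R (a (l.1 * n.+1 ^ l.2)%N) l.1.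
have c0 l : 0 <= c l by rewrite invr_ge0 exprn_ge0.
apply: (@le_trans _ _ (avg Q (fun x => \sum_(l <- L) \sum_(l' <- L)
    c l * c l' * (w x * (K l x * K l' x))))).
  apply: ler_avg => x.
  have -> : \sum_(l <- L) \sum_(l' <- L) c l * c l' * (w x * (K l x * K l' x)) =
      w x * (\sum_(l <- L) c l * K l x) ^+ 2.
    rewrite expr2 mulr_suml mulr_sumr; apply: eq_bigr => l _.
    rewrite !mulr_sumr; apply: eq_bigr => l' _; ring.
  apply: ler_wpM2l => //; rewrite lerXn2r ?nnegrE//.
  - by apply: avg_ge0 => t; rewrite ler0n.
  - by apply: sumr_ge0 => l _; rewrite mulr_ge0 ?cls_ge0.
  - exact: fiber_avg_new_hit_le.
have LP l : l \in L -> (l.1 %| N)%N.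
  by move=> /allpairsP[[m k] [/= mS _ ->]]; exact: smooth_dvd.
apply: (@le_trans _ _ (\sum_(l <- L) \sum_(l' <- L) c l * c l' * weight R (lcmn l.1 l'.1))).
  rewrite avg_sum big_seq [leRHS]big_seq; apply: ler_sum => l lL.
  rewrite avg_sum big_seq [leRHS]big_seq; apply: ler_sum => l' lL'.
  rewrite avgZ; apply: ler_wpM2l; first by rewrite mulr_ge0.
  apply: avg_cls2_le => //; first exact: weight_ge0.
  by move=> e; apply: sw; rewrite dvdn_lcm !LP.
have -> : \sum_(l <- L) \sum_(l' <- L) c l * c l' * weight R (lcmn l.1 l'.1) =
    (\sum_(1 <= k < T.+1) (n.+1%:R ^+ k)^-1) ^+ 2 * lcm_weight R T n.
  set S := \sum_(1 <= k < T.+1) _.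
  have inner l : \sum_(l' <- L) c l * c l' * weight R (lcmn l.1 l'.1) =
      c l * (S * \sum_(b <- smooth T n) weight R (lcmn l.1 b)).
    rewrite /L big_allpairs_dep !mulr_sumr; apply: eq_bigr => b _.
    by rewrite mulr_suml mulr_sumr; apply: eq_bigr => k _; rewrite /c /=; ring.
  rewrite (eq_bigr _ (fun l _ => inner l)) /L big_allpairs_dep mulr_sumr.
  apply: eq_bigr => m _; rewrite expr2 -mulrA mulr_suml.
  by apply: eq_bigr => k _.
rewrite ler_wpM2r ?lcm_weight_ge0// lerXn2r ?nnegrE ?divr_ge0 ?sum_expV_le//.
by apply: sumr_ge0 => k _; rewrite invr_ge0 exprn_ge0.
Qed.

Lemma distortion_step (R : realType) D a T M n (w : nat -> R) :
  prime n.+1 -> (n < M)%N -> (forall x, 0 <= w x) ->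
  has_period (smooth_modulus T n) w -> spread T M n w ->
  exists w' : nat -> R, [/\ forall x, 0 <= w' x,
    has_period (smooth_modulus T n.+1) w', spread T M n.+1 w' &
    avg (smooth_modulus T M) (fun x => w x * (avoids D a (smooth T n) x)%:R)
      - (2 / n.+1%:R) ^+ 2 * lcm_weight R T n <=
    avg (smooth_modulus T M) (fun x => w' x * (avoids D a (smooth T n.+1) x)%:R)].
Proof.
move=> pn nM w0 wN sw; set N := smooth_modulus T n; set Q := smooth_modulus T M.
set N' := smooth_modulus T n.+1.
have Q0 : (0 < Q)%N by exact: smooth_modulus_gt0.
have NN' : (N %| N')%N by exact: smooth_modulus_dvd.
have N'Q : (N' %| Q)%N by exact: smooth_modulus_dvd.
have NQ := dvdn_trans NN' N'Q.
set b := new_hit D a T n.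
have bN' : has_period N' b by exact: new_hit_periodic.
have bQ := periodic_dvd N'Q bN'.
have [h [h02 hN' h1 hb]] := @distortion R Q N N' b Q0 bQ bN' NN'.
have h0 x : 0 <= h x by have /andP[] := h02 x.
have h2 x : h x <= 2 by have /andP[] := h02 x.
have hQ := periodic_dvd N'Q hN'.
(* Functions of period [N] do not see the reweighting by [h]. *)
have cond (g : nat -> R) : has_period N g ->
    avg Q (fun x => g x * h x) = avg Q g.
  move=> gN; rewrite (avg_fiber_avg Q0 NQ hQ gN).
  by apply: eq_avg => x; rewrite h1 mulr1.
exists (fun x => w x * h x); split.
- by move=> x; rewrite mulr_ge0.
- by move=> x; rewrite hN' (periodic_dvd NN' wN).
- move=> m e /(dvdn_smooth_modulus pn)[d [k [dN kT ->]]].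
  have cdp : coprime d n.+1.
    by apply: coprime_dvdl dN _; exact: smooth_modulus_coprime.
  have d0 := dvdn_gt0 (smooth_modulus_gt0 T n) dN.
  have clsN f : has_period N (cls R f d) := periodic_dvd dN (cls_periodic R f d).
  have wcN : has_period N (fun x => w x * cls R e d x) by move=> x; rewrite wN clsN.
  rewrite weightMX//; case: k kT => [|k] kT.
    (* Without the new prime the class has period [N], so its mass is unchanged. *)
    rewrite expn0 muln1 mulr1; apply: le_trans (sw d e dN).
    rewrite -(cond _ wcN) le_eqVlt; apply/orP; left; apply/eqP.
    by apply: eq_avg => x; rewrite mulrAC.
  (* Bound [h] by 2; the class mod the prime power is then independent of the [N]-periodic rest and
     contributes its density. *)
  apply: (@le_trans _ _ (avg Q (fun x => 2 * ((w x * cls R e d x) * cls R e (n.+1 ^ k.+1) x)))).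
    apply: ler_avg => x; have := cls_mulM R e d (n.+1 ^ k.+1) x.
    have := cls_ge0 R e (d * n.+1 ^ k.+1) x; have := w0 x; have := h0 x; have := h2 x.
    set c := cls _ _ _ _; set c' := cls _ _ _ _; set c'' := cls _ _ _ _ => h2x h0x wx c0 cc.
    have -> : 2 * (w x * c' * c'') = (w x * 2) * (c' * c'') by ring.
    by apply: ler_pM => //; [rewrite mulr_ge0|apply: ler_wpM2l].
  have pkQ : (n.+1 ^ k.+1 %| Q)%N.
    by apply: dvdn_trans N'Q; rewrite /N' /= pn dvdn_mull// dvdn_exp2l.
  rewrite avgZ (avg_fiber_avg Q0 NQ (periodic_dvd pkQ (cls_periodic R e _)) wcN).
  rewrite (eq_avg _ (g := fun x => (n.+1%:R ^+ k.+1)^-1 * (w x * cls R e d x))); last first.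
    move=> x; rewrite fiber_avg_cls ?expn_gt0 ?natrX 1?mulrC//.
    by apply: coprimeXr; exact: smooth_modulus_coprime.
  rewrite avgZ mulrA mulrC; apply: ler_wpM2r; last exact: sw.
  by rewrite divr_ge0// exprn_ge0.
- set u := avoids D a (smooth T n).
  have uN : has_period N u by exact: avoids_periodic.
  rewrite lerBlDr.
  have wuN : has_period N (fun x => w x * (u x)%:R) by move=> x; rewrite wN uN.
  rewrite -(cond _ wuN).
  (* The loss is the newly hit mass under [w * h], which [distortion] bounds by a second moment. *)
  apply: (@le_trans _ _ (avg Q (fun x => w x * h x * (avoids D a (smooth T n.+1) x)%:R) +
     avg Q (fun x => w x * (h x * (b x)%:R)))).
    rewrite -avgD; apply: ler_avg => x; rewrite avoidsS// -/u -/b.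
    have wh : 0 <= w x * h x by rewrite mulr_ge0.
    by case: (u x); case: (b x); rewrite /= ?mulr0 ?mul0r ?mulr1 ?addr0 ?add0r.
  rewrite lerD2l.
  rewrite (@avg_fiber_avg R Q N (fun x => h x * (b x)%:R)) //; last by move=> x; rewrite hQ bQ.
  apply: le_trans (second_moment_le D a pn nM w0 sw).
  by apply: ler_avg => x; apply: ler_wpM2l.
Qed.

(** * Iteration over the primes above [y] *)

(** A loss of order [n ^ (- 3 / 2)] is compared with a difference of inverse square roots, so that
    the losses telescope. *)
Lemma distortion_loss_le (R : realType) (C : R) (n : nat) : 0 <= C -> (0 < n)%N ->
  (2 / n.+1%:R) ^+ 2 * (C * Num.sqrt n%:R) <=
  8 * C * ((Num.sqrt n%:R)^-1 - (Num.sqrt n.+1%:R)^-1) :> R.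
Proof.
move=> C0 n0; set s := Num.sqrt n%:R; set t := Num.sqrt n.+1%:R.
have s2 : s ^+ 2 = n%:R by rewrite sqr_sqrtr.
have t2 : t ^+ 2 = n.+1%:R by rewrite sqr_sqrtr.
have s0 : 0 < s by rewrite sqrtr_gt0 ltr0n.
have t0 : 0 < t by rewrite sqrtr_gt0 ltr0n.
have st1 : t ^+ 2 = s ^+ 2 + 1 by rewrite t2 s2 -natr1.
have st : s <= t by nra.
have e : s^-1 - t^-1 = (s * t * (s + t))^-1.
  have -> : s^-1 - t^-1 = (t ^+ 2 - s ^+ 2) / (s * t * (s + t)) by field; lra.
  by rewrite st1 addrAC subrr add0r mul1r.
rewrite e -t2; have -> : (2 / t ^+ 2) ^+ 2 * (C * s) = C * (4 * s / t ^+ 4) by field; lra.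
rewrite (mulrC 8 C) -(mulrA C 8); apply: ler_wpM2l => //.
rewrite ler_pdivrMr ?exprn_gt0// mulrAC ler_pdivlMr ?mulr_gt0 ?addr_gt0//.
have -> : 4 * s * (s * t * (s + t)) = 4 * t * (s * s * (s + t)) by ring.
have -> : 8 * t ^+ 4 = 4 * t * (t * t * (t + t)) by ring.
apply: ler_wpM2l; first by rewrite mulr_ge0// ltW.
by apply: ler_pM; [nra|lra|nra|lra].
Qed.

Lemma distortion_iter (R : realType) D a T M y (C : R) : 0 <= C -> (0 < y)%N ->
  (forall n, (0 < n)%N -> lcm_weight R T n <= C * Num.sqrt n%:R) ->
  forall n, (y <= n <= M)%N ->
  exists w : nat -> R, [/\ forall x, 0 <= w x,
    has_period (smooth_modulus T n) w, spread T M n w &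
    avg (smooth_modulus T M) (fun x => (avoids D a (smooth T y) x)%:R)
      - 8 * C * ((Num.sqrt y%:R)^-1 - (Num.sqrt n%:R)^-1) <=
    avg (smooth_modulus T M) (fun x => w x * (avoids D a (smooth T n) x)%:R)].
Proof.
move=> C0 y0 HC n /andP[yn]; rewrite -(subnK yn).
elim: (n - y)%N => [|i IH] nM.
  (* At stage [y] the measure is uniform, and [1 / m] is at most [weight R m]. *)
  exists (fun=> 1); split => //.
  - move=> m c mn; rewrite (eq_avg _ (g := cls R c m)) => [|x]; last by rewrite mul1r.
    rewrite avg_cls ?smooth_modulus_gt0 ?(dvdn_gt0 _ mn) ?smooth_modulus_gt0//.
      by rewrite /weight ler_peMl ?invr_ge0// exprn_ege1// ler1n.
    by apply: dvdn_trans mn _; exact: smooth_modulus_dvd.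
  - rewrite add0n subrr mulr0 subr0 le_eqVlt; apply/orP; left; apply/eqP.
    by apply: eq_avg => x; rewrite mul1r.
have [w [w0 wN sw Hw]] := IH (ltnW nM); set l := (i + y)%N in nM w0 wN sw Hw *.
rewrite addSn -/l.
have l0 : (0 < l)%N by rewrite addn_gt0 y0 orbT.
have loss0 := distortion_loss_le C0 l0.
have loss : (2 / l.+1%:R) ^+ 2 * lcm_weight R T l <=
    8 * C * ((Num.sqrt l%:R)^-1 - (Num.sqrt l.+1%:R)^-1).
  by apply: le_trans loss0; apply: ler_wpM2l; rewrite ?sqr_ge0 ?HC.
have lossD : 8 * C * ((Num.sqrt y%:R)^-1 - (Num.sqrt l.+1%:R)^-1) =
    8 * C * ((Num.sqrt y%:R)^-1 - (Num.sqrt l%:R)^-1) +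
    8 * C * ((Num.sqrt l%:R)^-1 - (Num.sqrt l.+1%:R)^-1) by ring.
rewrite lossD opprD addrA.
have [pn|npn] := boolP (prime l.+1).
  have [w' [w'0 w'N sw' Hw']] := distortion_step D a pn nM w0 wN sw.
  by exists w'; split => //; apply: le_trans Hw'; apply: lerB.
(* A composite [l.+1] changes nothing, and the loss budgeted for it is nonnegative. *)
have pl : 0 <= (2 / l.+1%:R) ^+ 2 * lcm_weight R T l.
  by rewrite mulr_ge0 ?sqr_ge0 ?lcm_weight_ge0.
exists w; split => //.
- by rewrite /= (negPf npn).
- by move=> m c; rewrite /= (negPf npn); exact: sw.
- by rewrite smoothS (negPf npn); apply: le_trans Hw; rewrite gerBl (le_trans pl).
Qed.

(** * Euler product bounds *)

Lemma prime_recip_sumS (R : realType) n : prime_recip_sum R n.+1 =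
  prime_recip_sum R n + (if prime n.+1 then n.+1%:R^-1 else 0).
Proof.
by rewrite /prime_recip_sum big_mkcond big_nat_recr//= -big_mkcond.
Qed.

Lemma prime_recip_sum_homo (R : realType) m n : (m <= n)%N ->
  prime_recip_sum R m <= prime_recip_sum R n.
Proof.
move=> mn; rewrite /prime_recip_sum [leRHS](@big_cat_nat _ _ _ m.+1)//=.
by rewrite lerDl sumr_ge0// => i _; rewrite invr_ge0.
Qed.

Lemma lcm_weight_sqrt (R : realType) :
  exists2 C : R, 0 <= C &
    forall T n, (0 < n)%N -> lcm_weight R T n <= C * Num.sqrt n%:R.
Proof.
(* With this value [expR (kap * l)] is [2 ^ (l / 2)], at most the square root of [n]. Completing the
   square absorbs the term [80 * s] into [kap * s ^+ 2 + 1600 / kap]. *)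
pose kap : R := ln 2 / 2.
have kap0 : 0 < kap by rewrite divr_gt0// ln_gt0 ?ltr1n.
exists (expR (10 + 1600 / kap)) => [|T n n0]; first exact: expR_ge0.
set l := trunc_log 2 n.
have ln_ : (2 ^ l <= n)%N by exact: trunc_logP.
have nl : (n < 2 ^ l.+1)%N by exact: trunc_log_ltn.
apply: le_trans (lcm_weight_le R T n) _.
have := prime_recip_sum_le R l.
have := prime_recip_sum_homo R (ltnW nl).
set P := prime_recip_sum R n; set s := Num.sqrt l%:R => h1 h2.
have s2 : s ^+ 2 = l%:R by rewrite sqr_sqrtr.
apply: (@le_trans _ _ (expR (10 + 1600 / kap + kap * l%:R))).
  rewrite ler_expR -s2.
  have : 0 <= (kap * s - 40) ^+ 2 / kap by rewrite divr_ge0 ?sqr_ge0// ltW.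
  have -> : (kap * s - 40) ^+ 2 / kap = kap * s ^+ 2 - 80 * s + 1600 / kap.
    by field; lra.
  lra.
rewrite expRD ler_wpM2l ?expR_ge0//.
rewrite -[leLHS]ger0_norm ?expR_ge0// -sqrtr_sqr ler_wsqrtr//.
rewrite -expRM_natl (_ : 2 * (kap * l%:R) = l%:R * ln 2); last by rewrite /kap; field.
by rewrite expRM_natl lnK ?posrE// -natrX ler_nat.
Qed.

(* Euler product; [p^(sg - 1) <= 3/4] allows [1 / (1 - x) <= exp (4 x)]. *)
Lemma sum_smooth_powR_le (R : realType) (sg X : R) T n :
  0 <= sg <= 1 / 2 -> (forall p : nat, (0 < p <= n)%N -> p%:R `^ sg <= X) ->
  \sum_(d <- smooth T n) d%:R `^ (sg - 1) <= expR (4 * X * prime_recip_sum R n).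
Proof.
move=> /andP[sg0 sg1]; elim: n => [|n IH] HX.
  rewrite /prime_recip_sum !big_seq1 big_mkcond big_nat1 /=.
  by rewrite mulr0 expR0 powR1.
have {}IH : \sum_(d <- smooth T n) d%:R `^ (sg - 1) <= expR (4 * X * prime_recip_sum R n).
  by apply: IH => p /andP[p0 pn]; apply: HX; rewrite p0 leqW.
rewrite prime_recip_sumS mulrDr expRD.
have [pn|npn] := boolP (prime n.+1); last first.
  by rewrite smoothS (negPf npn) /= mulr0 expR0 mulr1.
set x := n.+1%:R `^ (sg - 1) : R.
have p0 : 0 < n.+1%:R :> R by rewrite ltr0n.
have x0 : 0 <= x by exact: powR_ge0.
have xX : x <= X / n.+1%:R.
  rewrite /x powRB; last by rewrite pnatr_eq0 implybT.
  by rewrite powRr1// ler_pM2r ?invr_gt0// HX ?leqnn.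
have x34 : x <= 3 / 4.
  apply: (@le_trans _ _ (2 `^ (- (1 / 2)))).
    apply: (@le_trans _ _ (n.+1%:R `^ (- (1 / 2)))).
      by rewrite ler_powR ?ler1n//; lra.
    rewrite !powRN lef_pV2 ?posrE ?powR_gt0//.
    by rewrite ge0_ler_powR ?nnegrE// ler_nat prime_gt1.
  rewrite div1r powRN powR12_sqrt// -[leRHS]invrK lef_pV2 ?posrE ?invr_gt0 ?sqrtr_gt0//.
  rewrite -[leLHS]ger0_norm ?invr_ge0// -sqrtr_sqr ler_wsqrtr//; lra.
rewrite smoothS pn big_allpairs_dep.
apply: (@le_trans _ _ (\sum_(d <- smooth T n) d%:R `^ (sg - 1) * \sum_(0 <= k < T.+1) x ^+ k)).
  apply: ler_sum => d _; rewrite mulr_sumr; apply: ler_sum => k _.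
  rewrite natrM natrX powRM// ?exprn_ge0//.
  by rewrite -[n.+1%:R ^+ k]powR_mulrn// -powRrM [k%:R * _]mulrC powRrM powR_mulrn ?powR_ge0.
rewrite -mulr_suml; apply: ler_pM => //.
- by apply: sumr_ge0 => d _; exact: powR_ge0.
- by apply: sumr_ge0 => k _; exact: exprn_ge0.
apply: (@le_trans _ _ (1 + 4 * x)).
  suff : \sum_(0 <= k < T.+1) x ^+ k <= (1 - x)^-1.
    move=> /le_trans; apply; rewrite -[leLHS]mul1r ler_pdivrMr; nra.
  rewrite -[leRHS]mul1r ler_pdivlMr; last by lra.
  rewrite big_mkord; have := subrX1 x T.+1 => xT.
  by have := exprn_ge0 T.+1 x0; lra.
apply: (le_trans (expR_ge1Dx _)); rewrite ler_expR -mulrA ler_wpM2l//.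
Qed.

(** * The tail of the smooth numbers *)

(** For [d > K] the factor [(d / K) ^ sg] is at least 1; inserting it lets the sum run over all
    smooth numbers. *)
Lemma rankin (R : realType) (sg X K : R) T n : 0 < K ->
  0 <= sg <= 1 / 2 -> (forall p : nat, (0 < p <= n)%N -> p%:R `^ sg <= X) ->
  \sum_(d <- smooth T n | K < d%:R) d%:R^-1 <=
    K `^ (- sg) * expR (4 * X * prime_recip_sum R n).
Proof.
move=> K0 sgP HX; have /andP[sg0 _] := sgP.
apply: le_trans (ler_wpM2l (powR_ge0 _ _) (sum_smooth_powR_le T sgP HX)).
rewrite big_mkcond mulr_sumr; apply: ler_sum => d _.
case: ifPn => Kd; last by rewrite mulr_ge0 ?powR_ge0.
have d0 : 0 < d%:R :> R by exact: lt_trans Kd.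
have -> : d%:R^-1 = d%:R `^ (- sg) * d%:R `^ (sg - 1) :> R.
  rewrite -powRD; last by rewrite (gt_eqF d0) implybT.
  by rewrite addrA addNr add0r powRN powRr1// ltW.
apply: ler_wpM2r; first exact: powR_ge0.
by rewrite !powRN lef_pV2 ?posrE ?powR_gt0// ge0_ler_powR ?nnegrE ?(ltW K0) ?(ltW d0) ?(ltW Kd).
Qed.

Lemma ler_sum_sub_uniq (R : realType) (I : eqType) (s t : seq I) (F : I -> R) :
  uniq s -> {subset s <= t} -> (forall i, 0 <= F i) ->
  \sum_(i <- s) F i <= \sum_(i <- t) F i.
Proof.
move=> us st F0; elim: s t us st => [|x s IH] t; first by rewrite big_nil sumr_ge0.
move=> /= /andP[xs us] st; have xt : x \in t by apply: st; rewrite mem_head.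
rewrite big_cons (big_rem x xt) /= lerD2l; apply: IH => // y ys.
have yx : y != x by apply: contraNneq xs => <-.
have : y \in t by apply: st; rewrite in_cons ys orbT.
by rewrite (perm_mem (perm_to_rem xt)) in_cons (negPf yx).
Qed.

(** The constant [c] makes the Rankin factor equal to [exp (- (9 (2 + A) + 1) J)]; the Euler product
    costs at most [exp (9 (2 + A) J)], leaving [exp (- J)]. *)
Lemma smooth_tail_le (R : realType) (A J T : nat) : (0 < A)%N -> (0 < J)%N ->
  let c : R := 2 * A%:R * ln 2 * (9 * (2 + A%:R) + 1) in
  \sum_(d <- smooth T (2 ^ (A * J)) |
      expR (c * J%:R ^+ 2 / ln (J + 1)%:R) < d%:R) d%:R^-1 <= (2 ^+ J)^-1 :> R.
Proof.
move=> A0 J0; cbv zeta; set c : R := _ * _ * _ * (_ + 1); set K := expR _; set m := (A * J)%N.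
have m0 : (0 < m)%N by rewrite muln_gt0 A0.
have A0R : 1 <= A%:R :> R by rewrite ler1n.
have J0R : 1 <= J%:R :> R by rewrite ler1n.
have l2 : 0 < ln 2 :> R by rewrite ln_gt0 ?ltr1n.
have lJ : 0 < ln (J + 1)%:R :> R by rewrite ln_gt0// ltr1n addn1.
have mE : m%:R = A%:R * J%:R :> R by rewrite natrM.
set lj := ln _ in lJ *.
(* This exponent makes [(2 ^ m) `^ sg = sqrt (J + 1)]. *)
pose sg : R := lj / (2 * m%:R * ln 2).
have sgd : 0 < 2 * m%:R * ln 2 :> R by rewrite !mulr_gt0// ltr0n.
have sg0 : 0 <= sg by rewrite divr_ge0// ltW.
have sgP : 0 <= sg <= 1 / 2.
  rewrite sg0 /= ler_pdivrMr// (_ : 1 / 2 * _ = m%:R * ln 2); last by field.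
  rewrite mulrC mulr_natr -lnXn// ler_ln ?posrE ?exprn_gt0// ?ltr0n ?addn1//.
  rewrite -natrX ler_nat; apply: (@leq_ltn_trans m); first by rewrite leq_pmull.
  exact: ltn_expl.
pose X := expR (lj / 2).
have X2 : X ^+ 2 = J%:R + 1.
  rewrite -expRM_natl (_ : 2 * (lj / 2) = lj); last by field.
  by rewrite lnK ?posrE ?ltr0n ?addn1// -natr1.
have X0 : 0 < X by exact: expR_gt0.
have pX (p : nat) : (0 < p <= 2 ^ m)%N -> p%:R `^ sg <= X.
  move=> /andP[p0 pm]; rewrite /powR pnatr_eq0 gtn_eqF// ler_expR.
  apply: (@le_trans _ _ (sg * ln (2 ^+ m))).
    by rewrite ler_wpM2l// ler_ln ?posrE ?exprn_gt0 ?ltr0n// -natrX ler_nat.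
  rewrite lnXn// -[_ *+ m]mulr_natr /sg le_eqVlt; apply/orP; left; apply/eqP.
  by field; rewrite gt_eqF//= pnatr_eq0 -lt0n.
apply: (le_trans (rankin T (expR_gt0 _) sgP pX)).
have -> : K `^ (- sg) = expR (- ((9 * (2 + A%:R) + 1) * J%:R)).
  rewrite /powR gt_eqF ?expR_gt0// /K expRK -/lj; congr expR.
  rewrite /sg /c mE; field.
  by rewrite !gt_eqF// ltr0n.
rewrite -expRD; apply: (@le_trans _ _ (expR (- J%:R))).
  rewrite ler_expR; set P := prime_recip_sum _ _; set s := Num.sqrt m%:R : R.
  have s2 : s ^+ 2 = m%:R by rewrite sqr_sqrtr.
  have s1 : 1 <= s by rewrite -sqrtr1 ler_wsqrtr// ler1n.
  have PE : P <= 1 / 2 + 4 * s.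
    rewrite /P -(prednK m0); apply: (le_trans (prime_recip_sum_le R m.-1)).
    by rewrite lerD2l ler_wpM2l// ler_wsqrtr// ler_nat leq_pred.
  have h1 : X * P <= X * (9 / 2 * s) by rewrite ler_wpM2l ?(ltW X0)//; lra.
  (* By AM-GM [2 X s] is at most [X ^ 2 + s ^ 2], where both squares are linear in [J]. *)
  have h2 : 0 <= (X - s) ^+ 2 by exact: sqr_ge0.
  have h3 : 2 * (X * s) <= J%:R + 1 + A%:R * J%:R.
    rewrite -mE -X2 -s2 -subr_ge0; apply: le_trans h2 _.
    by rewrite le_eqVlt; apply/orP; left; apply/eqP; ring.
  have h4 : 4 * X * P <= 9 * (2 + A%:R) * J%:R by lra.
  lra.
rewrite expRN lef_pV2 ?posrE ?expR_gt0 ?exprn_gt0//.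
rewrite -[J%:R]mulr1 expRM_natl lerXn2r ?nnegrE ?expR_ge0//.
exact: le_trans (expR_ge1Dx 1).
Qed.

(** * Remaining density and the contrapositive *)

(** The classes of [D1] leave density at least [2 ^ (- size D1)], and each smooth modulus [d] of
    [D2] removes density at most [1 / d]. *)
Lemma avoids_density (R : realType) (D1 D2 : seq nat) (a : nat -> nat) T M y :
  (y <= M)%N ->
  all (fun d => [&& 0 < d, d <= M & d <= T])%N (D1 ++ D2) -> uniq D2 ->
  (exists n, all (fun d => n != a d %[mod d])%N D1) ->
  (2 ^+ size D1)^-1 - \sum_(d <- [seq d <- D2 | d \in smooth T y]) d%:R^-1 <=
  avg (smooth_modulus T M) (fun x => (avoids (mem (D1 ++ D2)) a (smooth T y) x)%:R : R).
Proof.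
move=> yM /allP DM uD [n nD]; set Q := smooth_modulus T M.
have Q0 : (0 < Q)%N by exact: smooth_modulus_gt0.
have dQ d : d \in D1 ++ D2 -> (d %| Q)%N.
  by move=> /DM/and3P[d0 dM dT]; apply: smooth_dvd; exact: mem_smooth_le.
pose l := [seq (a d, d) | d <- D1].
have lall : all (fun rq => 0 < rq.2)%N l /\ all (fun rq => rq.2 %| Q)%N l.
  split; apply/allP => _ /mapP[d dD1 ->] /=.
    by have /and3P[] : [&& 0 < d, d <= M & d <= T]%N by apply: DM; rewrite mem_cat dD1.
  by apply: dQ; rewrite mem_cat dD1.
have un : exists n, uncovered l n by exists n; rewrite /uncovered all_map.
have := @uncovered_density R Q l Q0 lall.1 lall.2 un.
rewrite size_map; set s := [seq d <- D2 | _] => dens.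
have -> : \sum_(d <- s) d%:R^-1 = avg Q (fun x => \sum_(d <- s) cls R (a d) d x).
  rewrite avg_sum big_seq [RHS]big_seq; apply: eq_bigr => d.
  rewrite mem_filter => /andP[_ dD2]; have dD : d \in D1 ++ D2 by rewrite mem_cat dD2 orbT.
  by rewrite avg_cls ?dQ//; have /and3P[] := DM d dD.
rewrite lerBlDr -avgD; apply: le_trans dens _; apply: ler_avg => x.
have s0 (t : seq nat) : 0 <= \sum_(d <- t) cls R (a d) d x.
  by apply: sumr_ge0 => d _; exact: cls_ge0.
have [_|/allPn[d dS]] := boolP (avoids _ _ _ _).
  by rewrite ler_wpDr// ler_nat; case: (uncovered _ _).
rewrite negb_imply negbK => /andP[dD xd]; rewrite add0r.
move: dD; rewrite inE mem_cat => /orP[dD1|dD2].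
  have -> : uncovered l x = false by apply/negP => /allP/(_ _ (map_f _ dD1)); rewrite /= xd.
  exact: s0.
have ds : d \in s by rewrite mem_filter dS.
rewrite (big_rem d ds) /= {1}/cls xd ler_wpDr//.
by rewrite ler_nat; case: (uncovered _ _).
Qed.

(** Put [J = (size D1).+1]. Of the density [2 * 2 ^ (- J)] left by [D1], the smooth part of [D2]
    takes at most half and the reweightings lose less than the other half. *)
Lemma sparse_extension_not_covering (R : realType) :
  exists2 c : R, 0 < c & forall (D1 D2 : seq nat) (a : nat -> nat),
    all (fun d => 0 < d)%N (D1 ++ D2) -> uniq D2 ->
    (forall d, d \in D2 ->
      expR (c * (size D1).+1%:R ^+ 2 / ln ((size D1).+1 + 1)%:R) < d%:R) ->
    (exists n, all (fun d => n != a d %[mod d])%N D1) ->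
    exists x, all (fun d => x != a d %[mod d])%N (D1 ++ D2).
Proof.
have [C C0 HC] := lcm_weight_sqrt R.
(* With [8 * C < 2 ^ L] and [A = 2 * L.+1], the square root of [y] is [2 ^ (L.+1 * J)], so the total
   loss stays below [2 ^ (- J)]. *)
pose L := Num.bound (8 * C).
have LC : 8 * C < 2 ^+ L.
  apply: lt_le_trans (archi_boundP _) _; first by rewrite mulr_ge0.
  by rewrite -natrX ler_nat ltnW// ltn_expl.
pose A := (2 * L.+1)%N.
have A0 : (0 < A)%N by [].
exists (2 * A%:R * ln 2 * (9 * (2 + A%:R) + 1)).
  by rewrite !mulr_gt0 ?ltr0n ?ln_gt0 ?ltr1n// addr_gt0// mulr_gt0// addr_gt0 ?ltr0n.
move=> D1 D2 a Dpos uD HK un; set J := (size D1).+1 in HK *.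
pose y := (2 ^ (A * J))%N.
(* [M] bounds every modulus; taken both as prime bound and as exponent cap, it puts all moduli in
   [smooth M M]. *)
pose M := (y + \sum_(d <- D1 ++ D2) d)%N.
have yM : (y <= M)%N by exact: leq_addr.
have y0 : (0 < y)%N by rewrite expn_gt0.
have DM : all (fun d => [&& 0 < d, d <= M & d <= M])%N (D1 ++ D2).
  apply/allP => d dD; rewrite (allP Dpos)//= andbb /M (big_rem d dD) /=.
  by rewrite addnCA leq_addr.
have dens := avoids_density R yM DM uD un.
have tail : \sum_(d <- [seq d <- D2 | d \in smooth M y]) d%:R^-1 <= (2 ^+ J)^-1 :> R.
  apply: le_trans (smooth_tail_le R M A0 (ltn0Sn (size D1))).
  rewrite -[leRHS]big_filter; apply: ler_sum_sub_uniq => [||d]; last by rewrite invr_ge0.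
    exact: filter_uniq.
  by move=> d; rewrite !mem_filter => /andP[dS dD2]; rewrite dS HK.
have [|w [w0 wN _ Hw]] := @distortion_iter R (mem (D1 ++ D2)) a M M y C C0 y0 (HC M) M.
  by rewrite yM leqnn.
have loss : 8 * C * ((Num.sqrt y%:R)^-1 - (Num.sqrt M%:R)^-1) < (2 ^+ J)^-1.
  have sy : Num.sqrt y%:R = 2 ^+ (L.+1 * J) :> R.
    by rewrite /y natrX /A -mulnA (mulnC 2) exprM sqrtr_sqr ger0_norm ?exprn_ge0//.
  apply: (@le_lt_trans _ _ (8 * C * (Num.sqrt y%:R)^-1)).
    by rewrite ler_wpM2l ?mulr_ge0// gerBl invr_ge0 sqrtr_ge0.
  rewrite sy mulSn exprD invfM mulrCA -[ltRHS]mulr1 ltr_pM2l ?invr_gt0 ?exprn_gt0//.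
  rewrite ltr_pdivrMr ?exprn_gt0// mul1r; apply: lt_le_trans LC _.
  by rewrite ler_weXn2l ?ler1n// leq_pmulr.
have pos : 0 < avg (smooth_modulus M M)
    (fun x => w x * (avoids (mem (D1 ++ D2)) a (smooth M M) x)%:R).
  apply: lt_le_trans Hw; rewrite subr_gt0; apply: lt_le_trans loss _.
  apply: le_trans dens; rewrite lerBrDr; apply: (le_trans (lerD (lexx _) tail)).
  have : (2 ^+ size D1)^-1 = (2 ^+ J)^-1 + (2 ^+ J)^-1 :> R.
    by rewrite /J exprS invfM; field; rewrite expf_neq0.
  by move=> ->.
have [x xP] : exists x, avoids (mem (D1 ++ D2)) a (smooth M M) x.
  apply/not_existsP => no; move: pos; rewrite /avg big1 ?mul0r ?ltxx// => t _.
  by case: (avoids _ _ _ t) (no t) => //; rewrite mulr0.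
exists x; apply/allP => d dD; have /and3P[d0 dM _] := allP DM d dD.
by have := allP xP d (mem_smooth_le d0 dM dM); rewrite /= dD.
Qed.

(** * Passage to integer progressions *)

(** The members [s] and [s + m] of a class differ by [m], so any modulus of the same class divides
    [m]. *)
Lemma congruence_class_inj r r' q q' :
  congruence_class r q = congruence_class r' q' -> q = q'.
Proof.
have half s s' m m' : congruence_class s m = congruence_class s' m' -> (m' %| m)%N.
  move=> E; have h0 : congruence_class s m s by [].
  have h1 : congruence_class s m (s + m%:Z) by rewrite /congruence_class /= modzDr.
  move: h0 h1; rewrite E /congruence_class /= => <- /eqP.
  by rewrite eqz_mod_dvd addrAC subrr add0r dvdzE.
by move=> E; apply/eqP; rewrite eqn_dvd (half _ _ _ _ E) (half _ _ _ _ (esym E)).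
Qed.

(* Indices are 0-based: the ordinal j stands for the (j+1)-st smallest modulus. *)
Theorem theorem1 (R : realType) :
  exists c : R, 0 < c /\
    forall (k : nat) (r : 'I_k -> int) (q : 'I_k -> nat),
      (forall i : 'I_k, (1 <= q i)%N) ->
      (forall i j : 'I_k, (i < j)%N -> (q i < q j)%N) ->
      minimal_covering_system [set congruence_class (r i) (q i) | i in [set: 'I_k]] ->
      forall j : 'I_k,
        (q j)%:R <= expR (c * j.+1%:R ^+ 2 / ln (j.+1 + 1)%:R) :> R.
Proof.
have [c c0 core] := sparse_extension_not_covering R.
exists c; split => // k r q q0 qlt [[_ _ cov] minC] j.
rewrite leNgt; apply/negP => qj.
have q_inj : injective q.
  move=> i i' e; apply: ord_inj; case: (ltngtP i i') => // /qlt; by rewrite e ltnn.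
(* A natural representative of the residue belonging to modulus [d]; 0 is a dummy value off the
   moduli. *)
pose a d : nat := if [pick i | q i == d] is Some i then `|(r i %% d)%Z|%N else 0%N.
have aE i (x : nat) : (x == a (q i) %[mod q i])%N -> congruence_class (r i) (q i) x%:Z.
  have qi0 : (q i)%:Z != 0 by rewrite eqz_nat -lt0n.
  rewrite /a; case: pickP => [i' /eqP/q_inj ->|/(_ i)]; last by rewrite eqxx.
  move=> /eqP xe; rewrite /congruence_class /= -(modz_mod (r i)).
  rewrite -[in RHS](gez0_abs (modz_ge0 (r i) qi0)) !modz_nat; congr Posz.
  exact: xe.
have aE' i (x : nat) : congruence_class (r i) (q i) x%:Z -> (x == a (q i) %[mod q i])%N.
  have qi0 : (q i)%:Z != 0 by rewrite eqz_nat -lt0n.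
  rewrite /a; case: pickP => [i' /eqP/q_inj ->|/(_ i)]; last by rewrite eqxx.
  rewrite /congruence_class /= -(modz_mod (r i)) => xi; apply/eqP.
  move: xi; rewrite -(gez0_abs (modz_ge0 (r i) qi0)) !modz_nat => -[xi].
  by rewrite xi /= modn_mod.
(* [D1] has [j] elements, so [(size D1).+1] is the 1-based index of [q j], which itself goes into
   [D2]. *)
pose D1 := [seq q i | i <- [seq i : 'I_k <- enum 'I_k | (i < j)%N]].
pose D2 := [seq q i | i <- [seq i : 'I_k <- enum 'I_k | (j <= i)%N]].
have sD1 : size D1 = j.
  rewrite size_map size_filter -(count_map val (fun i => i < j)%N) val_enum_ord.
  by rewrite -size_filter (filter_iota_ltn 0 (ltnW (ltn_ord j))) size_iota.
have [| |||x xP] := core D1 D2 a.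
- by apply/allP => d; rewrite mem_cat => /orP[] /mapP[i _ ->].
- by rewrite map_inj_uniq// filter_uniq ?enum_uniq.
- move=> d /mapP[i]; rewrite mem_filter => /andP[ji _] ->.
  rewrite sD1; apply: lt_le_trans qj _; rewrite ler_nat.
  by move: ji; rewrite leq_eqVlt => /orP[/eqP/ord_inj ->//|/qlt/ltnW].
(* Distinct moduli make class [j] differ from the earlier ones, so these form a proper subsystem and
   by minimality miss an integer. *)
- pose F := [set congruence_class (r i) (q i) | i in [set i : 'I_k | (i < j)%N]].
  have /minC : F `<` [set congruence_class (r i) (q i) | i in [set: 'I_k]].
    split=> [_ [i _ <-]|sub]; first by exists i.
    have [|i /= ij /congruence_class_inj/q_inj e] := sub (congruence_class (r j) (q j)).
      by exists j.
    by rewrite e ltnn in ij.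
  move=> nF.
  have [z zP] : exists z : int, forall i : 'I_k, (i < j)%N -> ~ congruence_class (r i) (q i) z.
    apply: contra_notP nF => /forallNP no; apply/seteqP; split => // z _.
    have /existsNP[i /not_implyP[ij /contrapT zi]] := no z.
    by exists (congruence_class (r i) (q i)) => //; exists i.
  (* The missed integer may be negative; reduction modulo the product of all moduli gives a natural
     number with the same residues. *)
  pose P := (\prod_(i < k) q i)%N.
  have P0 : P%:Z != 0 by rewrite eqz_nat -lt0n prodn_gt0.
  exists `|(z %% P)%Z|%N; apply/allP => _ /mapP[i + ->].
  rewrite mem_filter => /andP[ij _]; apply/negP => /aE.
  rewrite gez0_abs ?modz_ge0// /congruence_class /=.
  suff -> : ((z %% P)%Z = z %[mod q i])%Z by exact: zP.
  apply/eqP; rewrite eqz_mod_dvd [X in _ - X](divz_eq z P) opprD addrCA subrr addr0.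
  rewrite dvdzE abszN abszM dvdn_mull//.
  by rewrite /P (bigD1 i)//= dvdn_mulr.
have : [set: int] x%:Z by [].
rewrite -cov => -[_ [i _ <-] /aE' xi].
have : q i \in D1 ++ D2.
  rewrite mem_cat; have [ij|ji] := ltnP i j; apply/orP.
    by left; apply/map_f; rewrite mem_filter ij mem_enum.
  by right; apply/map_f; rewrite mem_filter ji mem_enum.
by move=> /(allP xP); rewrite xi.
Qed.
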